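(* For any $k\in\mathbb{N}$, $k\ge 2$, the mechanical system in the plane $\mathbb{C}$ with the flat metric and force function $U(z)=|z|^{2k-2}$, restricted to its zero-energy surface, admits a 5-parameter family of smooth integrable reflection walls without ruling out the scalings and the rotations, and a 3-parameter family of smooth integrable reflection walls when ruling out the scalings and the rotations (i.e. when curves which differ only by scalings and rotations are identified).
   Context: The mechanical system with force function $U$ in the plane with the flat metric has Hamiltonian (energy) $E=\frac{|w|^2}{2}-U(z)$. For a curve $\mathcal{B}$, the mechanical billiard restricted to $\{E=e\}$ consists of the motions with energy $e$, reflected elastically at $\mathcal{B}$ (tangential component of the momentum kept, normal component reversed). $\mathcal{B}$ is called an integrable reflection wall at energy $e$ if there is an additional non-trivial (independent of $E$) first integral defined on $\{E=e\}$, preserved by the motion and by the reflections at $\mathcal{B}$. It is not required that the billiard mapping be always well-defined. *)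

(* Defs.v *)
From HB Require Import structures.
From mathcomp Require Import all_boot all_order all_algebra.
From mathcomp Require Import all_classical all_reals all_analysis.
Set Implicit Arguments.
Unset Strict Implicit.
Unset Printing Implicit Defensive.
Import Order.TTheory GRing.Theory Num.Theory.
Import numFieldNormedType.Exports.
Local Open Scope classical_set_scope.
Local Open Scope ring_scope.

(* The plane C is identified with R * R.  The norm that the library puts on a
   product is the sup norm; it is used only through the topology it induces, and
   all Euclidean notions come from [dot] and [cmod]. *)
Notation plane R := (R * R)%type.

(* A phase point is a pair (position, momentum). *)
Notation phase R := (plane R * plane R)%type.

Definition dot (R : realType) (u v : plane R) : R := u.1 * v.1 + u.2 * v.2.

Definition cmod (R : realType) (u : plane R) : R := Num.sqrt (dot u u).

(* [smooth_on] is used only for finite-dimensional V, where having directional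
   derivatives of all orders, all continuous on the open set O, is the usual
   C^oo regularity. *)
Fixpoint Cn_on (R : realType) (V : normedModType R) (n : nat) (O : set V)
    (f : V -> R) : Prop :=
  match n with
  | 0%N => forall x, O x -> {for x, continuous f}
  | m.+1 => (forall x v, O x -> derivable f x v) /\
            (forall v, Cn_on m O (fun x => 'D_v f x))
  end.

Definition smooth_on (R : realType) (V : normedModType R) (O : set V)
    (f : V -> R) : Prop := forall n, Cn_on n O f.

Definition grad (R : realType) (f : plane R -> R) (z : plane R) : plane R :=
  ('D_((1, 0) : plane R) f z, 'D_((0, 1) : plane R) f z).

Definition energy (R : realType) (U : plane R -> R) (x : phase R) : R :=
  cmod x.2 ^+ 2 / 2 - U x.1.

(* Solutions are taken on arbitrary open intervals, since the flow need not be
   complete. *)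
Definition motion (R : realType) (U : plane R -> R) (e a b : R)
    (z w : R -> plane R) : Prop :=
  forall t, a < t < b ->
    [/\ is_derive t (1 : R) z (w t),
        is_derive t (1 : R) w (grad U (z t)) &
        energy U (z t, w t) = e].

(* Orthogonal reflection of w in the line orthogonal to n; it depends only on
   the direction of n. *)
Definition reflect (R : realType) (n w : plane R) : plane R :=
  w - (2 * dot w n / dot n n) *: n.

(* Points of {E = e} at which dE <> 0, i.e. where this level set is a
   hypersurface.  The remaining points are the equilibria of energy e. *)
Definition regular_level (R : realType) (U : plane R -> R) (e : R) :
    set (phase R) :=
  [set x | energy U x = e /\ exists v, 'D_v (energy U) x != 0].

Definition independent_at (R : realType) (F E : phase R -> R) (x : phase R) :
    Prop :=
  forall alpha beta : R,
    (forall v, alpha * 'D_v F x + beta * 'D_v E x = 0) ->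
    alpha = 0 /\ beta = 0.

(* An additional first integral on {E = e}.  A smooth function on the
   hypersurface [regular_level U e] is represented by an extension to an open
   neighbourhood; whether dF and dE are independent on the level does not depend
   on the extension.  No smoothness is asked at the equilibria. *)
Definition first_integral (R : realType) (U : plane R -> R) (e : R)
    (F : phase R -> R) : Prop :=
  [/\ exists O : set (phase R),
        [/\ open O, regular_level U e `<=` O & smooth_on O F],
      forall a b z w, motion U e a b z w ->
        forall s t, a < s < b -> a < t < b -> F (z s, w s) = F (z t, w t) &
      regular_level U e `<=`
        closure [set x | regular_level U e x /\
                         independent_at F (energy U) x]].

(* A closed embedded smooth curve of the plane is always the regular zero set of
   some globally defined smooth function. *)
Definition defines (R : realType) (g : plane R -> R) (B : set (plane R)) :
    Prop :=
  [/\ smooth_on setT g, B = [set z | g z = 0] &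
      forall z, B z -> grad g z <> 0].

(* Connectedness and closedness (the latter by [defines]) keep the endpoints of
   arcs, or the choice of several curves of one confocal pencil, from counting
   as extra parameters of a family of walls. *)
Definition smooth_integrable_wall (R : realType) (U : plane R -> R) (e : R)
    (B : set (plane R)) : Prop :=
  [/\ B !=set0, connected B &
      exists g, defines g B /\
      exists F, first_integral U e F /\
        (forall z w, B z -> energy U (z, w) = e ->
           F (z, reflect (grad g z) w) = F (z, w))].

Definition scale_rotate (R : realType) (r theta : R) (z : plane R) : plane R :=
  (r * (cos theta * z.1 - sin theta * z.2),
   r * (sin theta * z.1 + cos theta * z.2)).

Definition same_up_to_scale_rotation (R : realType) (B B' : set (plane R)) :
    Prop :=
  exists r theta : R, 0 < r /\ B' = scale_rotate r theta @` B.

(* The set W of curves, taken modulo the equivalence sim, is an n-parameter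
   family: it is parametrized by an open subset P of R^n, smoothly and with
   every class hit by exactly one parameter. *)
Definition parameter_family (R : realType) (n : nat)
    (sim : set (plane R) -> set (plane R) -> Prop)
    (W : set (set (plane R))) : Prop :=
  exists (P : set 'rV[R]_n) (B : 'rV[R]_n -> set (plane R)),
    [/\ open P, P !=set0,
        exists G : 'rV[R]_n * plane R -> R,
          smooth_on (P `*` setT) G /\
          (forall a, P a -> defines (fun z => G (a, z)) (B a)),
        (forall a, P a -> W (B a)) /\
        (forall D, W D -> exists a, P a /\ sim (B a) D) &
        forall a b, P a -> P b -> sim (B a) (B b) -> a = b].

Definition force (R : realType) (k : nat) (z : plane R) : R :=
  cmod z ^+ (2 * k - 2)%N.

(* Main.v *)
Require Import Defs.
From mathcomp Require Import all_boot all_order all_algebra.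
From mathcomp Require Import all_classical all_reals all_analysis.
From mathcomp Require Import ring lra.

(* Let k = n + 1.  At energy 0 the conformal map q = z ^ k straightens the
   motions: p = w / conj (z ^ n) is constant and q moves along a line of
   direction p.  A conic {Q = 0} of the q-plane is an integrable wall for
   straight lines, because the discriminant of the restriction of Q to the line
   q + R p depends on the line only, and at a point of the conic it equals
   (grad Q . p)^2, which reflection preserves.  Pulling back by z ^ k the
   ellipses that enclose the origin gives connected closed walls.  An ellipse is
   recovered from its pull-back by intersecting it with lines through the
   origin, so there are 5 parameters.  Scalings and rotations act on the linear
   part of Q as a nonzero complex factor, so when that part is nonzero it can be
   normalized in exactly one way, which leaves 3 parameters. *)

Set Implicit Arguments.
Unset Strict Implicit.
Unset Printing Implicit Defensive.
Import Order.TTheory GRing.Theory Num.Theory.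
Import numFieldNormedType.Exports.
Local Open Scope classical_set_scope.
Local Open Scope ring_scope.

(** * Directional derivatives, and smoothness of rational functions *)

Section Derivation.
Variables (R : realType) (V : normedModType R).
Implicit Types (f g : V -> R) (x v : V) (df dg : R).

Lemma is_derive_add f g x v df dg :
  is_derive x v f df -> is_derive x v g dg ->
  is_derive x v (fun y => f y + g y) (df + dg).
Proof. by move=> Hf Hg; exact: is_deriveD. Qed.

Lemma is_derive_opp f x v df :
  is_derive x v f df -> is_derive x v (fun y => - f y) (- df).
Proof. by move=> Hf; exact: is_deriveN. Qed.

Lemma is_derive_mul f g x v df dg :
  is_derive x v f df -> is_derive x v g dg ->
  is_derive x v (fun y => f y * g y) (df * g x + f x * dg).
Proof.
move=> Hf Hg; apply: (@is_derive_eq _ _ _ (f * g)).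
by rewrite /GRing.scale /= addrC mulrC.
Qed.

Lemma is_derive_exp f n x v df :
  is_derive x v f df ->
  is_derive x v (fun y => f y ^+ n) (n%:R * f x ^+ n.-1 * df).
Proof.
by move=> Hf; have := is_deriveX n Hf; rewrite exprfctE.
Qed.

Lemma is_derive_inv f x v df :
  f x != 0 -> is_derive x v f df ->
  is_derive x v (fun y => (f y)^-1) (- df / f x ^+ 2).
Proof.
move=> f0 [Df <-]; apply: DeriveDef; first exact: derivableV.
by rewrite deriveV // /GRing.scale /= mulNr mulNr mulrC.
Qed.

Lemma is_derive_const (c : R) x v : is_derive x v (fun=> c) 0.
Proof. exact: is_derive_cst. Qed.

(** Difference quotients commute with a linear map, so its continuity alone carries the limit
    over. *)
Lemma is_derive_linear_comp (U : normedModType R) (W : normedModType R)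
    (l : W -> U) (f : V -> W) x v (df : W) :
  linear l -> continuous l ->
  is_derive x v f df -> is_derive x v (l \o f) (l df).
Proof.
move=> ll cl [Df <-].
have lB a b : l (a - b) = l a - l b.
  by rewrite addrC -scaleN1r ll scaleN1r addrC.
have l0 : l 0 = 0 by rewrite -(subrr 0) lB subrr.
have lZ (a : R) b : l (a *: b) = a *: l b.
  by have := ll a b 0; rewrite !addr0 l0 addr0.
have H : (fun h => h^-1 *: (((l \o f) \o shift x) (h *: v) - (l \o f) x)) @ 0^'
    --> l ('D_v f x).
  rewrite (_ : (fun h => _) =
    l \o (fun h : R => h^-1 *: ((f \o shift x) (h *: v) - f x))).
    by apply: continuous_cvg; [exact: cl | exact: Df].
  by apply/funext => h /=; rewrite lZ lB.
by apply: DeriveDef; [apply/cvg_ex; eexists; exact: H | exact: cvg_lim H].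
Qed.

Lemma is_derive_linear (l : V -> R) x v :
  linear l -> continuous l -> is_derive x v l (l v).
Proof.
by move=> ll cl; apply: (@is_derive_linear_comp _ _ l id).
Qed.

(* Rational functions of linear coordinates form a class that is closed under
   directional derivatives, which makes their smoothness an induction on the
   order. *)
Inductive rational_on (O : set V) : (V -> R) -> Prop :=
| rational_const c : rational_on O (fun=> c)
| rational_linear l : linear l -> continuous l -> rational_on O l
| rational_add f g :
    rational_on O f -> rational_on O g -> rational_on O (fun x => f x + g x)
| rational_mul f g :
    rational_on O f -> rational_on O g -> rational_on O (fun x => f x * g x)
| rational_inv f : rational_on O f -> (forall x, O x -> f x != 0) ->
    rational_on O (fun x => (f x)^-1).

Lemma rational_opp O f : rational_on O f -> rational_on O (fun x => - f x).
Proof.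
move=> Hf; rewrite (_ : (fun x => - f x) = fun x => -1 * f x).
  by apply: rational_mul => //; exact: rational_const.
by apply/funext => x; rewrite mulN1r.
Qed.

Lemma rational_exp O f n : rational_on O f -> rational_on O (fun x => f x ^+ n).
Proof.
move=> Hf; elim: n => [|n IH]; first exact: rational_const.
by under eq_fun do rewrite exprS; exact: rational_mul.
Qed.

Lemma rational_continuous O f :
  rational_on O f -> forall x, O x -> {for x, continuous f}.
Proof.
elim=> {f} [c|l _ cl|f g _ IHf _ IHg|f g _ IHf _ IHg|f _ IHf f0] x Ox.
- exact: cst_continuous.
- exact: cl.
- by apply: continuousD; [exact: IHf | exact: IHg].
- by apply: continuousM; [exact: IHf | exact: IHg].
- by apply: continuousV; [exact: f0 | exact: IHf].
Qed.

Lemma rational_derive O f v : rational_on O f ->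
  exists2 df, rational_on O df & forall x, O x -> is_derive x v f (df x).
Proof.
elim=> {f} [c|l ll cl|f g Hf [df Rf Df] Hg [dg Rg Dg]
  |f g Hf [df Rf Df] Hg [dg Rg Dg]|f Hf [df Rf Df] f0].
- by exists (fun=> 0) => [|x _]; [exact: rational_const | exact: is_derive_const].
- by exists (fun=> l v) => [|x _]; [exact: rational_const | exact: is_derive_linear].
- exists (fun x => df x + dg x) => [|x Ox]; first exact: rational_add.
  by apply: is_derive_add; [exact: Df | exact: Dg].
- exists (fun x => df x * g x + f x * dg x) => [|x Ox].
    by apply: rational_add; exact: rational_mul.
  by apply: is_derive_mul; [exact: Df | exact: Dg].
- exists (fun x => - df x / f x ^+ 2) => [|x Ox].
    apply: rational_mul; first exact: rational_opp.
    apply: rational_inv; first exact: rational_exp.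
    by move=> x Ox; rewrite expf_neq0 // f0.
  by apply: is_derive_inv; [exact: f0 | exact: Df].
Qed.

Lemma rational_sub O O' f :
  O' `<=` O -> rational_on O f -> rational_on O' f.
Proof.
move=> sub; elim=> {f} [c|l ll cl|f g _ IHf _ IHg|f g _ IHf _ IHg|f _ IHf f0].
- exact: rational_const.
- exact: rational_linear.
- exact: rational_add.
- exact: rational_mul.
- by apply: rational_inv => // x /sub; exact: f0.
Qed.

(** A derivative sees only a neighbourhood, so on an open set equality passes to all orders. This
    serves [rational_smooth], where the derivative of a rational function is identified with a
    rational function on [O] only. *)
Lemma Cn_on_eq n (O : set V) f g :
  open O -> (forall x, O x -> f x = g x) -> Cn_on n O f -> Cn_on n O g.
Proof.
move=> oO; elim: n f g => [|n IH] f g fg /=.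
  move=> cf x Ox; have nO : \near x, f x = g x.
    by apply: filterS (open_nbhs_nbhs (conj oO Ox)).
  rewrite /prop_for /continuous_at -(fg x Ox).
  by apply: cvg_trans (cf x Ox); exact: near_eq_cvg.
have nO x : O x -> \near x, f x = g x.
  by move=> Ox; apply: filterS (open_nbhs_nbhs (conj oO Ox)).
move=> [df Cf]; split=> [x v Ox|v].
  exact: (near_eq_derivable (nO x Ox) (df x v Ox)).
apply: IH (Cf v) => x Ox; exact: (near_eq_derive v (nO x Ox)).
Qed.

Lemma rational_smooth (O : set V) f :
  open O -> rational_on O f -> smooth_on O f.
Proof.
move=> oO + n; elim: n f => [|n IH] f Hf /=; first exact: rational_continuous.
split=> [x v Ox|v].
  by have [df _ Df] := rational_derive v Hf; have [] := Df x Ox.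
have [df Rf Df] := rational_derive v Hf.
apply: Cn_on_eq (IH _ Rf) => // x Ox.
by have [_ ->] := Df x Ox.
Qed.

End Derivation.

(** * Coordinate functions and linear substitutions *)

Section Coordinates.
Variable R : realType.

Lemma rational_fst (O : set (plane R)) : rational_on O (fun z => z.1).
Proof.
by apply: rational_linear => // z; exact: cvg_fst.
Qed.

Lemma rational_snd (O : set (plane R)) : rational_on O (fun z => z.2).
Proof.
by apply: rational_linear => // z; exact: cvg_snd.
Qed.

Lemma rational_comp (V W : normedModType R) (O : set V) (l : V -> W) (f : W -> R) :
  linear l -> continuous l -> rational_on [set l x | x in O] f ->
  rational_on O (f \o l).
Proof.
move=> ll cl; elim=> {f} [c|f lf cf|f g _ IHf _ IHg|f g _ IHf _ IHg|f _ IHf f0].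
- exact: rational_const.
- apply: rational_linear => [a x y|x]; first by rewrite /= ll lf.
  by apply: continuous_comp; [exact: cl | exact: cf].
- exact: (rational_add IHf IHg).
- exact: (rational_mul IHf IHg).
- by apply: (rational_inv IHf) => x Ox; apply: f0; exists x.
Qed.

End Coordinates.

(** * Complex arithmetic on pairs of reals *)

Section PlaneAlgebra.
Variable R : realType.
Implicit Types (u v w z q p : plane R).

Definition cmul u v : plane R := (u.1 * v.1 - u.2 * v.2, u.1 * v.2 + u.2 * v.1).

Definition conjc u : plane R := (u.1, - u.2).

Definition cpow z n : plane R := iter n (cmul z) (1, 0).

(** The imaginary part of [cmul (conjc u) v], whose real part is [dot u v]. Along a line [q + t p]
    the value [cross q p] is constant: it is the angular momentum. *)
Definition cross u v : R := u.1 * v.2 - u.2 * v.1.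

Lemma cpowS z n : cpow z n.+1 = cmul z (cpow z n).
Proof. by []. Qed.

Lemma cmulC u v : cmul u v = cmul v u.
Proof. by congr pair; ring. Qed.

Lemma cpowM u v n : cpow (cmul u v) n = cmul (cpow u n) (cpow v n).
Proof.
elim: n => [|n IH]; first by rewrite /cmul /=; congr pair; ring.
by rewrite !cpowS IH; congr pair => /=; ring.
Qed.

Lemma cpow_real (r : R) n : cpow (r, 0) n = (r ^+ n, 0).
Proof.
elim: n => [|n IH] //; rewrite cpowS IH /cmul /= exprS.
by congr pair; ring.
Qed.

Lemma dot_cmul u v : dot (cmul u v) (cmul u v) = dot u u * dot v v.
Proof. by rewrite /dot /=; ring. Qed.

Lemma dot_cpow z n : dot (cpow z n) (cpow z n) = dot z z ^+ n.
Proof.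
elim: n => [|n IH]; first by rewrite /dot /= expr0; ring.
by rewrite cpowS dot_cmul IH exprS.
Qed.

Lemma dot_ge0 u : 0 <= dot u u.
Proof. by rewrite /dot addr_ge0 // -expr2 sqr_ge0. Qed.

Lemma dot_eq0 u : (dot u u == 0) = (u == 0).
Proof.
apply/eqP/eqP => [|->]; last by rewrite /dot /= mulr0 addr0.
case: u => x y; rewrite /dot /= -!expr2 => /eqP.
by rewrite paddr_eq0 ?sqr_ge0 // !sqrf_eq0 => /andP[/eqP-> /eqP->].
Qed.

Lemma dot_gt0 u : (0 < dot u u) = (u != 0).
Proof. by rewrite lt0r dot_ge0 andbT dot_eq0. Qed.

Lemma dot_sqr_cross u v : dot u v ^+ 2 + cross u v ^+ 2 = dot u u * dot v v.
Proof. by rewrite /dot /cross; ring. Qed.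

Lemma dotC u v : dot u v = dot v u.
Proof. by rewrite /dot; ring. Qed.

Lemma dot_reflect (n w : plane R) : n != 0 -> dot (Defs.reflect n w) n = - dot w n.
Proof.
rewrite -dot_eq0 => n0; rewrite /Defs.reflect.
set c := 2 * dot w n / dot n n.
have cE : c * dot n n = 2 * dot w n by rewrite /c divfK.
transitivity (dot w n - c * dot n n); first by rewrite /dot /= /GRing.scale /=; ring.
by rewrite cE; ring.
Qed.

End PlaneAlgebra.

(** * Product rules for maps into the plane *)

Section PlaneDerivation.
Variables (R : realType) (V : normedModType R).
Implicit Types (f g : V -> plane R) (x v : V) (df dg : plane R).

(** Stated by components, so that complex product rules reduce to the real one. *)
Definition is_derive2 x v f df :=
  is_derive x v (fun y => (f y).1) df.1 /\ is_derive x v (fun y => (f y).2) df.2.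

Lemma is_derive2P x v f df : is_derive x v f df -> is_derive2 x v f df.
Proof.
move=> Df; split.
  by apply: (@is_derive_linear_comp _ _ _ _ fst f) => // z; exact: cvg_fst.
by apply: (@is_derive_linear_comp _ _ _ _ snd f) => // z; exact: cvg_snd.
Qed.

Lemma is_derive2_eq x v f df df' :
  is_derive2 x v f df' -> df' = df -> is_derive2 x v f df.
Proof. by move=> ? <-. Qed.

Lemma is_derive_dot x v f g df dg :
  is_derive2 x v f df -> is_derive2 x v g dg ->
  is_derive x v (fun y => dot (f y) (g y)) (dot df (g x) + dot (f x) dg).
Proof.
move=> [f1 f2] [g1 g2].
apply: (is_derive_eq (is_derive_add (is_derive_mul f1 g1) (is_derive_mul f2 g2))).
by rewrite /dot; ring.
Qed.

Lemma is_derive_cross x v f g df dg :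
  is_derive2 x v f df -> is_derive2 x v g dg ->
  is_derive x v (fun y => cross (f y) (g y)) (cross df (g x) + cross (f x) dg).
Proof.
move=> [f1 f2] [g1 g2].
apply: (is_derive_eq (is_derive_add (is_derive_mul f1 g2)
  (is_derive_opp (is_derive_mul f2 g1)))).
by rewrite /cross; ring.
Qed.

Lemma is_derive2_cmul x v f g df dg :
  is_derive2 x v f df -> is_derive2 x v g dg ->
  is_derive2 x v (fun y => cmul (f y) (g y))
    (cmul df (g x) + cmul (f x) dg).
Proof.
move=> [f1 f2] [g1 g2]; split.
  apply: (is_derive_eq (is_derive_add (is_derive_mul f1 g1)
    (is_derive_opp (is_derive_mul f2 g2)))) => /=; ring.
apply: (is_derive_eq (is_derive_add (is_derive_mul f1 g2)
  (is_derive_mul f2 g1))) => /=; ring.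
Qed.

Lemma is_derive2_const x v (c : plane R) : is_derive2 x v (fun=> c) 0.
Proof. by split; exact: is_derive_const. Qed.

Lemma is_derive2_cpow x v f n df :
  is_derive2 x v f df ->
  is_derive2 x v (fun y => cpow (f y) n) (n%:R *: cmul (cpow (f x) n.-1) df).
Proof.
move=> Df; elim: n => [|n IH].
  by rewrite scale0r; exact: is_derive2_const.
apply: (is_derive2_eq (is_derive2_cmul Df IH)).
(* For [n = 0] the truncated [n.-1] gives a wrong exponent, which the coefficient 0 hides. *)
case: n {IH} => [|n] /=.
  by congr pair; rewrite /= /GRing.scale /=; ring.
by rewrite [in RHS]mulrS; congr pair; rewrite /= /GRing.scale /=; ring.
Qed.

Lemma is_derive2_scale x v (a : V -> R) f da df :
  is_derive x v a da -> is_derive2 x v f df ->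
  is_derive2 x v (fun y => a y *: f y) (da *: f x + a x *: df).
Proof.
by move=> Da [f1 f2]; split; apply: is_derive_mul.
Qed.

End PlaneDerivation.

Arguments cpow : simpl never.

(** * Conics and their Joachimsthal integral *)

Section Conics.
Variable R : realType.

(* [Conic a b g] is the quadric a |q|^2 + Re (conj b q^2) + Re (conj g q) = 1;
   in this form q |-> l q acts diagonally on the coefficients. *)
Record conic := Conic { modulus : R; quadr : plane R; linr : plane R }.
Implicit Types (c : conic) (q p : plane R).

Definition qform c q := modulus c * dot q q + dot (quadr c) (cmul q q).

Definition ceval c q := qform c q + dot (linr c) q - 1.

Definition cpolar c q p :=
  2 * (modulus c * dot q p + dot (quadr c) (cmul q p)) + dot (linr c) p.

Definition disc c := modulus c ^+ 2 - dot (quadr c) (quadr c).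

(* A quarter of the discriminant of t |-> ceval c (q + t p). *)
Definition joachimsthal c q p := cpolar c q p ^+ 2 / 4 - ceval c q * qform c p.

Definition jlin c p :=
  let d := ((linr c).2, - (linr c).1) in
  modulus c * dot p d + dot (quadr c) (cmul p d).

(** After expansion [q] survives only inside [cross q p], which does not change when [q] moves along
    [p]; this is the conservation along straight lines. *)
Lemma joachimsthalE c q p : joachimsthal c q p =
  (dot (linr c) p ^+ 2 / 4 + qform c p) +
  (jlin c p * cross q p - disc c * cross q p ^+ 2).
Proof.
rewrite /joachimsthal /cpolar /ceval /jlin /disc /qform /dot /cross /=.
by field.
Qed.

(** As the constant term of [ceval] is -1, these inequalities describe an ellipse with the origin
    inside. *)
Definition elliptic c := 0 < modulus c /\ 0 < disc c.

(** By Cauchy-Schwarz the term in [quadr c] is at most |quadr c| |q|^2 in absolute value, and a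
    positive [disc c] makes |quadr c| smaller than [modulus c]. *)
Lemma qform_gt0 c q : elliptic c -> q != 0 -> 0 < qform c q.
Proof.
move=> [a0 d0]; rewrite -dot_gt0 => q0.
have H : dot (quadr c) (cmul q q) ^+ 2 <= dot (quadr c) (quadr c) * dot q q ^+ 2.
  rewrite expr2 -[dot q q ^+ 2]dot_cmul -dot_sqr_cross -expr2 lerDl.
  exact: sqr_ge0.
have {}H : dot (quadr c) (cmul q q) ^+ 2 < (modulus c * dot q q) ^+ 2.
  apply: le_lt_trans H _; rewrite exprMn ltr_pM2r ?exprn_gt0 //.
  by move: d0; rewrite /disc subr_gt0.
have /ltr_normlP[] : `|dot (quadr c) (cmul q q)| < modulus c * dot q q.
  by rewrite -ltr_sqr ?nnegrE ?normr_ge0 ?mulr_ge0 ?ltW // real_normK ?num_real.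
by rewrite /qform => H1 H2; lra.
Qed.

Section Derivatives.
Variable V : normedModType R.
Implicit Types (f : V -> plane R) (x v : V).

Lemma is_derive_qform c x v f df : is_derive2 x v f df ->
  is_derive x v (fun y => qform c (f y))
    (2 * (modulus c * dot (f x) df + dot (quadr c) (cmul (f x) df))).
Proof.
move=> Df.
have H1 := is_derive_mul (is_derive_const (modulus c) x v) (is_derive_dot Df Df).
have H2 := is_derive_dot (is_derive2_const x v (quadr c)) (is_derive2_cmul Df Df).
apply: (is_derive_eq (is_derive_add H1 H2)).
by rewrite /dot /=; ring.
Qed.

Lemma is_derive_linr (b : plane R) x v f df : is_derive2 x v f df ->
  is_derive x v (fun y => dot b (f y)) (dot b df).
Proof.
move=> Df; apply: (is_derive_eq (is_derive_dot (is_derive2_const x v b) Df)).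
by rewrite /dot /=; ring.
Qed.

Lemma is_derive_ceval c x v f df : is_derive2 x v f df ->
  is_derive x v (fun y => ceval c (f y)) (cpolar c (f x) df).
Proof.
move=> Df; apply: (is_derive_eq (is_derive_add (is_derive_add
  (is_derive_qform c Df) (is_derive_linr (linr c) Df)) (is_derive_const (-1) x v))).
by rewrite /cpolar addr0.
Qed.

(** When [g] is stationary to first order, the expansion [joachimsthalE] varies only as a quadratic
    polynomial in [cross (f y) (g y)]. *)
Lemma is_derive_joachimsthal c x v (f g : V -> plane R) dm :
  is_derive2 x v g 0 -> is_derive x v (fun y => cross (f y) (g y)) dm ->
  is_derive x v (fun y => joachimsthal c (f y) (g y))
    ((jlin c (g x) - 2 * disc c * cross (f x) (g x)) * dm).
Proof.
move=> Dg Dm; under eq_fun do rewrite joachimsthalE.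
have H1 := is_derive_mul (is_derive_exp 2 (is_derive_linr (linr c) Dg))
  (is_derive_const 4^-1 x v).
have H2 := is_derive_add H1 (is_derive_qform c Dg).
have H3 : is_derive x v (fun y => jlin c (g y)) 0.
  rewrite /jlin; set d := (_, _).
  have E1 := is_derive_mul (is_derive_const (modulus c) x v)
    (is_derive_dot Dg (is_derive2_const x v d)).
  have E2 := is_derive_linr (quadr c) (is_derive2_cmul Dg (is_derive2_const x v d)).
  by apply: (is_derive_eq (is_derive_add E1 E2)); rewrite /dot /=; ring.
have H4 := is_derive_opp (is_derive_mul (is_derive_const (disc c) x v) (is_derive_exp 2 Dm)).
apply: (is_derive_eq (is_derive_add H2 (is_derive_add (is_derive_mul H3 Dm) H4))).
by rewrite /dot /=; ring.
Qed.

End Derivatives.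
End Conics.

(** * The momentum in the straightened plane *)

Section Momentum.
Variables (R : realType) (n : nat).
Implicit Types (z w : plane R).

(* w / conj (z ^ n), the momentum of the straight motion of z ^ n.+1. *)
Definition momentum z w : plane R :=
  (dot (cpow z n) (cpow z n))^-1 *: cmul w (cpow z n).

Lemma dot_cpow_gt0 z m : z != 0 -> 0 < dot (cpow z m) (cpow z m).
Proof. by move=> z0; rewrite dot_cpow exprn_gt0 // dot_gt0. Qed.

Lemma dot_momentum z w : dot w w = 2 * dot z z ^+ n -> z != 0 ->
  dot (momentum z w) (momentum z w) = 2.
Proof.
move=> E z0; have s0 := lt0r_neq0 (dot_cpow_gt0 n z0).
rewrite /momentum; move: s0 E (dot_cmul w (cpow z n)); rewrite -dot_cpow.
move: (dot _ _) (cmul _ _) => s u s0 -> E.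
transitivity (s^-1 ^+ 2 * dot u u); last by rewrite E; field.
by rewrite /dot /= /GRing.scale /=; ring.
Qed.

(** The factor [n] absorbs the case [n = 0], in which the truncated predecessor gives another
    power. *)
Lemma cpow_mulpred z : n%:R *: cmul (cpow z n.-1) z = n%:R *: cpow z n :> plane R.
Proof. by case: n => [|m]; rewrite ?scale0r //= cmulC. Qed.

Variable V : normedModType R.
Implicit Types (x v : V) (f g : V -> plane R).

(** With c = z^n the momentum is w / conj c, and the last hypothesis says that the numerator dw conj
    c - w conj dc of its quotient rule vanishes. *)
Lemma is_derive2_momentum x v f g df dg :
  is_derive2 x v f df -> is_derive2 x v g dg -> f x != 0 ->
  cmul dg (conjc (cpow (f x) n)) =
    cmul (g x) (conjc (n%:R *: cmul (cpow (f x) n.-1) df)) ->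
  is_derive2 x v (fun y => momentum (f y) (g y)) 0.
Proof.
move=> Df Dg f0 E; have s0 := lt0r_neq0 (dot_cpow_gt0 n f0).
have Dc := is_derive2_cpow n Df.
have Ds := @is_derive_inv _ _ (fun y => dot (cpow (f y) n) (cpow (f y) n))
  x v _ s0 (is_derive_dot Dc Dc).
apply: (is_derive2_eq (is_derive2_scale Ds (is_derive2_cmul Dg Dc))).
move: E s0; move: (cpow (f x) n) (_ *: cmul _ df) => c dc E s0.
transitivity ((dot c c)^-1 ^+ 2 *: (cmul (cmul c c) (cmul dg (conjc c)
   - cmul (g x) (conjc dc)))); last first.
  by rewrite E subrr; congr pair; rewrite /= /GRing.scale /=; ring.
by move: s0; rewrite /dot => s0; congr pair; rewrite /= /GRing.scale /=; field.
Qed.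

Lemma is_derive_cross_momentum x v f g df :
  is_derive2 x v f df ->
  is_derive2 x v (fun y => momentum (f y) (g y)) 0 ->
  is_derive x v (fun y => cross (cpow (f y) n.+1) (momentum (f y) (g y)))
    (n.+1%:R * cross (cmul (cpow (f x) n) df) (momentum (f x) (g x))).
Proof.
move=> Df Dg; apply: (is_derive_eq (is_derive_cross (is_derive2_cpow n.+1 Df) Dg)).
by rewrite /cross /= /GRing.scale /=; ring.
Qed.

End Momentum.

(** * Calculus on an interval: mean values and a Gronwall estimate *)

Section Interval.
Variable R : realType.
Implicit Types (f df : R -> R) (s t : R).

Lemma mean_value f df s t : s <= t ->
  (forall x, s <= x <= t -> is_derive x 1 f (df x)) ->
  exists2 c, s <= c <= t & f t - f s = df c * (t - s).
Proof.
move=> st Df.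
have [|| c] := @MVT_segment R f df s t st.
- by move=> x; rewrite in_itv /= => /andP[sx xt]; apply: Df; rewrite !ltW.
- apply: derivable_within_continuous => x; rewrite in_itv /= => Hx.
  by have [] := Df x Hx.
- by rewrite in_itv /=; exists c.
Qed.

Lemma derive0_constant f (a b : R) :
  (forall x, a < x < b -> is_derive x 1 f 0) ->
  forall s t, a < s < b -> a < t < b -> f s = f t.
Proof.
move=> Df s t; wlog st : s t / s <= t.
  by move=> H Hs Ht; case/orP: (le_total s t) => st; [|symmetry]; apply: H.
move=> /andP[sa _] /andP[_ tb].
have [x /andP[sx xt]|_ _] := @mean_value f (fun=> 0) s t st.
  by apply: Df; rewrite (lt_le_trans sa) //= (le_lt_trans xt).
by rewrite mul0r => /subr0_eq.
Qed.

(** The bound makes [f x * expR (C * x)] nondecreasing and [f x * expR (- C * x)] nonincreasing, so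
    a zero at one end leaves no room for a positive value at the other. *)
Lemma gronwall_zero f df (C : R) s t : s <= t ->
  (forall x, s <= x <= t -> [/\ is_derive x 1 f (df x), 0 <= f x &
     `|df x| <= C * f x]) ->
  f s = 0 <-> f t = 0.
Proof.
move=> st H.
have Ie (a x : R) : is_derive x (1 : R) (fun y => expR (a * y)) (a * expR (a * x)).
  have I := is_derive_mul (is_derive_const a x 1) (is_derive_id x (1 : R)).
  apply: (is_derive_eq (is_derive1_comp (is_derive_expR (a * x)) I)).
  by rewrite mul0r add0r mulr1 mulrC.
have Dh a x : s <= x <= t -> is_derive x (1 : R) (fun y => f y * expR (a * y))
    ((df x + a * f x) * expR (a * x)).
  move=> /H[Df _ _]; apply: (is_derive_eq (is_derive_mul Df (Ie a x))).
  by rewrite mulrDl mulrCA mulrA.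
have [c1 c1st E1] := mean_value st (Dh C).
have [c2 c2st E2] := mean_value st (Dh (- C)).
have P1 : 0 <= f t * expR (C * t) - f s * expR (C * s).
  rewrite E1 mulr_ge0 ?subr_ge0 // mulr_ge0 ?expR_ge0 //.
  have [_ _] := H _ c1st; rewrite ler_norml => /andP[]; lra.
have P2 : f t * expR (- C * t) - f s * expR (- C * s) <= 0.
  rewrite E2 mulr_le0_ge0 ?subr_ge0 // mulr_le0_ge0 ?expR_ge0 //.
  have [_ _] := H _ c2st; rewrite ler_norml => /andP[]; lra.
have [|_ fs _] := H s; first by rewrite lexx.
have [|_ ft _] := H t; first by rewrite lexx st.
split=> E0; apply/eqP; rewrite eq_le.
  move: P2; rewrite E0 mul0r subr0 pmulr_lle0 ?expR_gt0 // => ->.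
  by rewrite ft.
move: P1; rewrite E0 mul0r sub0r oppr_ge0 pmulr_lle0 ?expR_gt0 // => ->.
by rewrite fs.
Qed.

End Interval.

(** * The motions of energy zero *)

Section System.
Variables (R : realType) (n : nat).
Implicit Types (z w : plane R) (x v : phase R).

Local Notation U := (force (R := R) n.+1).

(** With [k = n + 1] the exponent [2 * k - 2] is [2 * n], so the square root inside [cmod]
    disappears. *)
Lemma forceE : U = fun z => dot z z ^+ n.
Proof.
apply/funext => z; rewrite /force mulnS addKn exprM /cmod sqr_sqrtr //.
exact: dot_ge0.
Qed.

Lemma energyE : energy U = fun x => dot x.2 x.2 / 2 - dot x.1 x.1 ^+ n.
Proof.
by apply/funext => x; rewrite /energy forceE /cmod sqr_sqrtr // dot_ge0.
Qed.

Lemma is_derive2_position x v : is_derive2 x v (fun y => y.1) v.1.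
Proof.
apply: is_derive2P; apply: (@is_derive_linear_comp _ _ _ _ fst id) => // y.
exact: cvg_fst.
Qed.

Lemma is_derive2_velocity x v : is_derive2 x v (fun y => y.2) v.2.
Proof.
apply: is_derive2P; apply: (@is_derive_linear_comp _ _ _ _ snd id) => // y.
exact: cvg_snd.
Qed.

Lemma is_derive_energy x v : is_derive x v (energy U)
  (dot x.2 v.2 - n%:R * dot x.1 x.1 ^+ n.-1 * (2 * dot x.1 v.1)).
Proof.
rewrite energyE.
have Dz := is_derive2_position x v; have Dw := is_derive2_velocity x v.
have H1 := is_derive_mul (is_derive_dot Dw Dw) (is_derive_const 2^-1 x v).
have H2 := is_derive_opp (is_derive_exp n (is_derive_dot Dz Dz)).
apply: (is_derive_eq (is_derive_add H1 H2)).
by rewrite !(dotC v.1) !(dotC v.2); field.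
Qed.

Lemma derive_energy x v : 'D_v (energy U) x =
  dot x.2 v.2 - n%:R * dot x.1 x.1 ^+ n.-1 * (2 * dot x.1 v.1).
Proof. by have [] := is_derive_energy x v. Qed.

Lemma grad_force z : grad U z = (2 * n%:R * dot z z ^+ n.-1) *: z.
Proof.
have D (v : plane R) : 'D_v U z = n%:R * dot z z ^+ n.-1 * (2 * dot z v).
  rewrite forceE.
  have Dz : is_derive2 z v id v by apply: is_derive2P; exact: is_derive_id.
  have [_ ->] := is_derive_exp n (is_derive_dot Dz Dz).
  by rewrite (dotC v); ring.
by rewrite /grad !D; congr pair; rewrite /dot /GRing.scale /=; ring.
Qed.

Lemma energy0 x : energy U x = 0 <-> dot x.2 x.2 = 2 * dot x.1 x.1 ^+ n.
Proof. by rewrite energyE; split=> H; lra. Qed.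

Hypothesis n0 : (0 < n)%N.

(** At z = 0 zero energy forces w = 0, and dE vanishes there. Elsewhere dE takes the positive value
    |w|^2 in the direction (0, w). *)
Lemma regular_levelP x : regular_level U 0 x <->
  x.1 != 0 /\ dot x.2 x.2 = 2 * dot x.1 x.1 ^+ n.
Proof.
split=> [[/energy0 E [v Dv]]|[z0 E]].
  split=> //; apply: contra_neq Dv => z0; rewrite derive_energy.
  have /eqP : dot x.2 x.2 = 0.
    by rewrite E z0 /dot /= mulr0 addr0 expr0n gtn_eqF ?mulr0.
  by rewrite dot_eq0 => /eqP ->; rewrite z0 /dot /=; ring.
split; first exact/energy0.
exists (0, x.2); rewrite derive_energy /= (_ : dot x.1 0 = 0); last first.
  by rewrite /dot /=; ring.
by rewrite !mulr0 subr0 E lt0r_neq0 // mulr_gt0 // exprn_gt0 // dot_gt0.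
Qed.

Section Motion.
Variables (a b : R) (z w : R -> plane R).
Hypothesis zw : motion U 0 a b z w.

Lemma motion_position t : a < t < b -> is_derive2 t (1 : R) z (w t).
Proof. by move=> /zw[Dz _ _]; exact: is_derive2P. Qed.

Lemma motion_velocity t : a < t < b ->
  is_derive2 t (1 : R) w ((2 * n%:R * dot (z t) (z t) ^+ n.-1) *: z t).
Proof. by move=> /zw[_ Dw _]; rewrite -grad_force; exact: is_derive2P. Qed.

Lemma motion_energy t : a < t < b -> dot (w t) (w t) = 2 * dot (z t) (z t) ^+ n.
Proof. by move=> /zw[_ _ /energy0]. Qed.

(** The equation of motion is w' = 2 n |z|^(2n-2) z and zero energy means |w|^2 = 2 |z|^(2n). Hence
    both sides of the stationarity condition of [is_derive2_momentum] equal n |w|^2 conj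
    (z^(n-1)). *)
Lemma motion_momentum t : a < t < b -> z t != 0 ->
  is_derive2 t (1 : R) (fun u => momentum n (z u) (w u)) 0.
Proof.
move=> tab z0.
apply: (is_derive2_momentum (motion_position tab) (motion_velocity tab)) => //.
have := motion_energy tab; rewrite -dot_cpow; move: (z t) (w t) => q v.
case: n n0 => // m _ /=; rewrite -dot_cpow cpowS; move: (cpow q m) => e E.
transitivity ((m.+1%:R * (2 * dot (cmul q e) (cmul q e))) *: conjc e).
  by congr pair; rewrite /= /dot /GRing.scale /=; ring.
by rewrite -E; congr pair; rewrite /= /dot /GRing.scale /=; ring.
Qed.

(** The point z^(n+1) has velocity (n+1) z^n w, a real multiple of the momentum, so their cross
    product vanishes. *)
Lemma motion_angular_momentum t : a < t < b -> z t != 0 ->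
  is_derive t (1 : R) (fun u => cross (cpow (z u) n.+1) (momentum n (z u) (w u))) 0.
Proof.
move=> tab z0; apply: (is_derive_eq (is_derive_cross_momentum
  (motion_position tab) (motion_momentum tab z0))).
by rewrite /momentum /cross /= /GRing.scale /=; ring.
Qed.

(** The momentum is meaningless at the origin, so motions must be shown unable to enter or leave it.
    Zero energy bounds the square of the derivative of |z|^2 by 8 |z|^(2n+2); as n >= 1, this yields
    a Gronwall bound for |z|^2 on a compact interval. *)
Lemma motion_origin s t : a < s < b -> a < t < b -> s <= t ->
  z s = 0 <-> z t = 0.
Proof.
move=> /andP[sa sb] /andP[ta tb] st.
have sub (x : R) : s <= x <= t -> a < x < b.
  by move=> /andP[sx xt]; rewrite (lt_le_trans sa) //= (le_lt_trans xt).
pose f u := dot (z u) (z u); pose df u := 2 * dot (z u) (w u).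
have Df (x : R) : s <= x <= t -> is_derive x (1 : R) f (df x).
  move=> /sub/motion_position Dz; apply: (is_derive_eq (is_derive_dot Dz Dz)).
  by rewrite (dotC (w x)) /df; ring.
have [c cst cmax] : exists2 c, s <= c <= t & forall x : R, s <= x <= t -> f x <= f c.
  have [|c] := @EVT_max R f s t st.
    apply: derivable_within_continuous => x; rewrite in_itv /= => Hx.
    by have [] := Df x Hx.
  by rewrite in_itv /= => Hc H; exists c => // x Hx; apply: H; rewrite in_itv.
have f0 (x : R) : 0 <= f x by exact: dot_ge0.
(* Here [f c] is the maximum of |z|^2 on the interval. The summand 1 makes [C ^+ 2] dominate
   [8 * f c ^+ n.-1], which avoids taking a square root. *)
pose C := 8 * f c ^+ n.-1 + 1.
have := @gronwall_zero R f df C s t st.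
have eq0 u : f u = 0 <-> z u = 0.
  by split=> /eqP; [rewrite dot_eq0 => /eqP|rewrite -dot_eq0 => /eqP].
rewrite (eq0 s) (eq0 t); apply => x Hx; split; [exact: Df|exact: f0|].
have C0 : 0 <= 8 * f c ^+ n.-1 by rewrite mulr_ge0 // exprn_ge0.
have CC : 8 * f c ^+ n.-1 <= C ^+ 2.
  by rewrite /C; move: C0; set y := 8 * _ => y0; nra.
rewrite -ler_sqr ?nnegrE ?normr_ge0 //; last by rewrite mulr_ge0 ?f0 // addr_ge0.
rewrite real_normK ?num_real // [leRHS]exprMn.
apply: (@le_trans _ _ (8 * f c ^+ n.-1 * f x ^+ 2)); last first.
  by rewrite ler_wpM2r ?sqr_ge0.
apply: (@le_trans _ _ (8 * f x ^+ n.-1 * f x ^+ 2)); last first.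
  rewrite ler_wpM2r ?sqr_ge0 // ler_wpM2l // lerXn2r ?nnegrE //; exact: cmax.
have := dot_sqr_cross (z x) (w x); rewrite (motion_energy (sub _ Hx)).
rewrite -/(f x) (_ : f x ^+ n = f x * f x ^+ n.-1); last first.
  by rewrite -exprS prednK.
rewrite /df => H; have := sqr_ge0 (cross (z x) (w x)); move: H.
by move: (cross _ _ ^+ 2) (f x ^+ n.-1) => ? ? H ?; lra.
Qed.

(** Either the motion rests at the origin, with zero velocity, or it never meets the origin and the
    integral has zero derivative. *)
Lemma joachimsthal_motion (c : conic R) s t : a < s < b -> a < t < b ->
  joachimsthal c (cpow (z s) n.+1) (momentum n (z s) (w s)) =
  joachimsthal c (cpow (z t) n.+1) (momentum n (z t) (w t)).
Proof.
move=> sab tab.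
have orig (u v : R) : a < u < b -> a < v < b -> z u = 0 -> z v = 0.
  by move=> Hu Hv; case/orP: (le_total u v) => uv;
     have [] := motion_origin _ _ uv.
have [zs0|zs0] := eqVneq (z s) 0.
  have zt0 := orig s t sab tab zs0.
  have w0 (u : R) : a < u < b -> z u = 0 -> w u = 0.
    move=> Hu zu; apply/eqP; rewrite -dot_eq0 (motion_energy Hu) zu.
    by rewrite /dot /= mulr0 addr0 expr0n gtn_eqF ?mulr0.
  by rewrite zs0 zt0 (w0 s) // (w0 t).
apply: (@derive0_constant R (fun u => joachimsthal c (cpow (z u) n.+1)
  (momentum n (z u) (w u))) a b) => // u Hu.
have zu0 : z u != 0 by apply: contra_neq zs0; exact: orig.
have H := is_derive_joachimsthal c (motion_momentum Hu zu0)
  (motion_angular_momentum Hu zu0).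
by apply: (is_derive_eq H); rewrite mulr0.
Qed.

End Motion.
End System.

(** * Rational maps into the plane, with the open sets and closures they give *)

Section RationalPlane.
Variables (R : realType) (V : normedModType R) (O : set V).
Implicit Types (f g : V -> plane R).

Definition rational2 f :=
  rational_on O (fun y => (f y).1) /\ rational_on O (fun y => (f y).2).

Lemma rational2_const (c : plane R) : rational2 (fun=> c).
Proof. by split; exact: rational_const. Qed.

Lemma rational2_cmul f g :
  rational2 f -> rational2 g -> rational2 (fun y => cmul (f y) (g y)).
Proof.
move=> [f1 f2] [g1 g2]; split => /=; apply: rational_add.
- exact: rational_mul.
- by apply: rational_opp; exact: rational_mul.
- exact: rational_mul.
- exact: rational_mul.
Qed.

Lemma rational2_cpow f n : rational2 f -> rational2 (fun y => cpow (f y) n).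
Proof.
move=> Hf; elim: n => [|n IH]; first exact: rational2_const.
exact: rational2_cmul.
Qed.

Lemma rational2_scale (a : V -> R) f :
  rational_on O a -> rational2 f -> rational2 (fun y => a y *: f y).
Proof. by move=> Ha [f1 f2]; split; exact: rational_mul. Qed.

Lemma rational_dot f g :
  rational2 f -> rational2 g -> rational_on O (fun y => dot (f y) (g y)).
Proof. by move=> [f1 f2] [g1 g2]; apply: rational_add; exact: rational_mul. Qed.

Lemma rational_qform (a : V -> R) b g f :
  rational_on O a -> rational2 b -> rational2 f ->
  rational_on O (fun y => qform (Conic (a y) (b y) (g y)) (f y)).
Proof.
move=> Ha Hb Hf; apply: rational_add.
  by apply: rational_mul => //; exact: rational_dot.
by apply: rational_dot => //; exact: rational2_cmul.
Qed.

Lemma rational_ceval (a : V -> R) b g f :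
  rational_on O a -> rational2 b -> rational2 g -> rational2 f ->
  rational_on O (fun y => ceval (Conic (a y) (b y) (g y)) (f y)).
Proof.
move=> Ha Hb Hg Hf; apply: rational_add; last exact: rational_const.
by apply: rational_add; [exact: rational_qform | exact: rational_dot].
Qed.

Lemma rational_joachimsthal c f g : rational2 f -> rational2 g ->
  rational_on O (fun y => joachimsthal c (f y) (g y)).
Proof.
case: c => a b d Hf Hg; apply: rational_add; last first.
  apply: rational_opp; apply: rational_mul.
    by apply: rational_ceval => //; [exact: rational_const|exact: rational2_const|
      exact: rational2_const].
  by apply: rational_qform => //; [exact: rational_const|exact: rational2_const].
apply: rational_mul; last exact: rational_const.
apply: rational_exp; apply: rational_add; last first.
  by apply: rational_dot => //; exact: rational2_const.
apply: rational_mul; first exact: rational_const.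
apply: rational_add.
  by apply: rational_mul; [exact: rational_const | exact: rational_dot].
by apply: rational_dot; [exact: rational2_const | exact: rational2_cmul].
Qed.

End RationalPlane.

Lemma rational2_linear (R : realType) (V : normedModType R) (O : set V)
    (l : V -> plane R) : linear l -> continuous l -> rational2 O l.
Proof.
move=> ll cl; split.
  apply: (@rational_comp _ _ _ O l fst) => //; exact: rational_fst.
apply: (@rational_comp _ _ _ O l snd) => //; exact: rational_snd.
Qed.

Lemma open_rational_gt0 (R : realType) (V : normedModType R) (f : V -> R) :
  rational_on setT f -> open [set x | 0 < f x].
Proof.
move=> Hf; apply: (@open_comp _ _ f [set y | 0 < y]); last exact: open_gt.
by move=> x _; exact: (rational_continuous Hf).
Qed.

Lemma continuous_pair (S T U : topologicalType) (f : S -> T) (g : S -> U) (x : S) :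
  {for x, continuous f} -> {for x, continuous g} ->
  {for x, continuous (fun y => (f y, g y))}.
Proof. by move=> cf cg; exact: cvg_pair. Qed.

Lemma continuous_phase (R : realType) (f : R -> phase R) (t : R) :
  rational2 setT (fun y => (f y).1) -> rational2 setT (fun y => (f y).2) ->
  {for t, continuous f}.
Proof.
move=> [f1 f2] [f3 f4].
rewrite (_ : f = fun y =>
  ((((f y).1).1, ((f y).1).2), (((f y).2).1, ((f y).2).2))); last first.
  by apply/funext => y; case: (f y) => [[? ?] [? ?]].
by apply: continuous_pair; apply: continuous_pair; exact: (rational_continuous (O := setT)).
Qed.

Lemma closure_path (R : realType) (T : topologicalType) (S : set T) (f : R -> T) :
  {for 0, continuous f} -> (forall h, 0 < h -> S (f h)) -> closure S (f 0).
Proof.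
move=> cf Sf B /cf [e e0 eB].
exists (f (e / 2)); split; first by apply: Sf; rewrite divr_gt0.
apply: eB; rewrite /ball /= sub0r normrN gtr0_norm ?divr_gt0 //.
by rewrite ltr_pdivrMr // ltr_pMr // ltr1n.
Qed.

(** * Independence of the wall integral and the energy *)

Section Integral.
Variables (R : realType) (n : nat) (c : conic R).
Hypothesis n0 : (0 < n)%N.
Implicit Types (z w q p u : plane R) (x v : phase R).

Local Notation U := (force (R := R) n.+1).

Definition pulled_conic z := ceval c (cpow z n.+1).

Definition wall_integral x := joachimsthal c (cpow x.1 n.+1) (momentum n x.1 x.2).

Lemma rational_wall_integral :
  rational_on [set x : phase R | 0 < dot x.1 x.1] wall_integral.
Proof.
set O := [set x | _].
have Hz : rational2 O (fun x : phase R => x.1).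
  by apply: rational2_linear => // y; exact: cvg_fst.
have Hw : rational2 O (fun x : phase R => x.2).
  by apply: rational2_linear => // y; exact: cvg_snd.
have Hc := rational2_cpow n Hz.
apply: rational_joachimsthal; first exact: rational2_cpow.
apply: rational2_scale; last exact: rational2_cmul.
apply: rational_inv; first exact: rational_dot.
by move=> x; rewrite /O /= dot_gt0 => x0; rewrite lt0r_neq0 // dot_cpow_gt0.
Qed.

(** The direction generates the scalings (z, w) -> (a z, a^n w), which fix the momentum and multiply
    the angular momentum by a^(n+1). *)
Lemma derive_wall_integral_scaling x : regular_level U 0 x ->
  'D_(x.1, n%:R *: x.2) wall_integral x =
  (jlin c (momentum n x.1 x.2)
    - 2 * disc c * cross (cpow x.1 n.+1) (momentum n x.1 x.2)) *
  (n.+1%:R * cross (cpow x.1 n.+1) (momentum n x.1 x.2)).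
Proof.
move=> /(regular_levelP n0)[z0 _]; set v := (_, _).
have Dp : is_derive2 x v (fun y => momentum n y.1 y.2) 0.
  apply: (is_derive2_momentum (is_derive2_position x v) (is_derive2_velocity x v)) => //=.
  by rewrite cpow_mulpred; congr pair; rewrite /= /GRing.scale /=; ring.
have [_ ->] := is_derive_joachimsthal c Dp
  (is_derive_cross_momentum (is_derive2_position x v) Dp).
by rewrite /v /= cpowS (cmulC x.1).
Qed.

(** The energy is homogeneous under these scalings, so on its zero level dE kills the scaling
    direction, while the differential of the integral does not; this gives [alpha = 0]. A direction
    with dE nonzero then gives [beta = 0]. *)
Lemma independent_wall_integral x : regular_level U 0 x ->
  cross (cpow x.1 n.+1) (momentum n x.1 x.2) != 0 ->
  jlin c (momentum n x.1 x.2)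
    != 2 * disc c * cross (cpow x.1 n.+1) (momentum n x.1 x.2) ->
  independent_at wall_integral (energy U) x.
Proof.
move=> rx m0 j0 alpha beta H.
have [z0 E] := (regular_levelP n0 x).1 rx.
have a0 : alpha = 0.
  have := H (x.1, n%:R *: x.2); rewrite derive_wall_integral_scaling //.
  rewrite derive_energy /= (_ : dot x.2 _ = n%:R * dot x.2 x.2); last first.
    by rewrite /dot /= /GRing.scale /=; ring.
  rewrite E (_ : dot x.1 x.1 ^+ n = dot x.1 x.1 * dot x.1 x.1 ^+ n.-1); last first.
    by rewrite -exprS prednK.
  rewrite (_ : n%:R * _ - _ = 0); last by ring.
  rewrite mulr0 addr0 => /eqP.
  by rewrite !mulf_eq0 subr_eq0 (negbTE m0) (negbTE j0) pnatr_eq0 !orbF => /eqP.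
split=> //; have [_ [v Dv]] := rx.
have /eqP := H v; rewrite a0 mul0r add0r mulf_eq0 (negbTE Dv) orbF.
by move=> /eqP.
Qed.

End Integral.

(** * Density of the independent points, and reflection at the wall *)

Section FirstIntegral.
Variables (R : realType) (n : nat).
Hypothesis n0 : (0 < n)%N.
Implicit Types (z w q p u : plane R) (x v : phase R).

Local Notation U := (force (R := R) n.+1).
Local Notation mom x := (momentum n x.1 x.2).
Local Notation ang x := (cross (cpow x.1 n.+1) (momentum n x.1 x.2)).

Lemma cpow_scale (a : R) z m : cpow (a *: z) m = a ^+ m *: cpow z m.
Proof.
rewrite (_ : a *: z = cmul (a, 0) z); last first.
  by congr pair; rewrite /= /GRing.scale /=; ring.
by rewrite cpowM cpow_real; congr pair; rewrite /= /GRing.scale /=; ring.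
Qed.

Lemma momentum_scale (a : R) z w : a != 0 ->
  momentum n (a *: z) (a ^+ n *: w) = momentum n z w.
Proof.
move=> a0; have an0 : a ^+ n != 0 by rewrite expf_neq0.
rewrite /momentum !cpow_scale; move: (cpow z n) (a ^+ n) an0 => e b b0.
rewrite (_ : dot (b *: e) (b *: e) = b ^+ 2 * dot e e); last first.
  by rewrite /dot /= /GRing.scale /=; ring.
rewrite (_ : cmul _ _ = b ^+ 2 *: cmul w e); last first.
  by congr pair; rewrite /= /GRing.scale /=; ring.
by rewrite scalerA invfM mulrAC mulVf ?mul1r // expf_neq0.
Qed.

Lemma momentum_cmul z w u : momentum n z (cmul u w) = cmul u (momentum n z w).
Proof. by congr pair; rewrite /= /GRing.scale /=; ring. Qed.

Lemma regular_scale (a : R) x : a != 0 -> regular_level U 0 x ->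
  regular_level U 0 (a *: x.1, a ^+ n *: x.2).
Proof.
move=> a0 /(regular_levelP n0)[z0 E]; apply/(regular_levelP n0); split => /=.
  by rewrite scaler_eq0 negb_or a0.
rewrite (_ : dot _ _ = (a ^+ n) ^+ 2 * dot x.2 x.2); last first.
  by rewrite /dot /= /GRing.scale /=; ring.
rewrite (_ : dot (a *: x.1) _ = a ^+ 2 * dot x.1 x.1); last first.
  by rewrite /dot /= /GRing.scale /=; ring.
by rewrite E exprMn exprAC mulrCA.
Qed.

(** If the condition on [jlin] fails at [x], scaling by 1 + h restores it for every h > 0: the
    momentum and [jlin] stay, while the nonzero angular momentum is multiplied by (1 + h)^(n+1) >
    1. *)
Lemma closure_scaling (c : conic R) x : 0 < disc c -> regular_level U 0 x ->
  ang x != 0 ->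
  closure [set y | regular_level U 0 y /\
    independent_at (wall_integral n c) (energy U) y] x.
Proof.
move=> d0 rx m0.
have [j0|j0] := eqVneq (jlin c (mom x)) (2 * disc c * ang x); last first.
  apply: subset_closure; split => //; exact: independent_wall_integral.
pose f (h : R) : phase R := ((1 + h) *: x.1, (1 + h) ^+ n *: x.2).
have -> : x = f 0.
  by rewrite /f addr0 expr1n !scale1r; case: x {rx m0 j0 f}.
have rh : rational_on setT (fun h : R => 1 + h).
  apply: rational_add; first exact: rational_const.
  by apply: rational_linear => // t; exact: cvg_id.
apply: closure_path.
  apply: continuous_phase; apply: rational2_scale.
  - exact: rh.
  - exact: rational2_const.
  - exact: rational_exp.
  - exact: rational2_const.
move=> h h0; have h1 : 1 + h != 0 by rewrite lt0r_neq0 // addr_gt0.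
have angf : ang (f h) = (1 + h) ^+ n.+1 * ang x.
  rewrite /f /= momentum_scale // (cpow_scale _ _ n.+1).
  by rewrite /cross /= /GRing.scale /=; ring.
split; first exact: regular_scale.
apply: independent_wall_integral => //; first exact: regular_scale.
  by rewrite angf mulf_neq0 // expf_neq0.
rewrite angf momentum_scale // j0 -subr_eq0 (_ : _ - _ =
  2 * disc c * ang x * (1 - (1 + h) ^+ n.+1)); last by ring.
rewrite mulf_neq0 //; first by rewrite mulf_neq0 // mulf_neq0 // lt0r_neq0.
by rewrite subr_eq0 lt_eqF // exprn_egt1 // ltrDl.
Qed.

(** Where the angular momentum vanishes, z^(n+1) and the momentum are parallel and nonzero, so
    turning the velocity by a small positive angle makes it nonzero. *)
Lemma closure_rotation x : regular_level U 0 x ->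
  closure [set y | regular_level U 0 y /\ ang y != 0] x.
Proof.
move=> rx; have [z0 E] := (regular_levelP n0 x).1 rx.
have [m0|m0] := eqVneq (ang x) 0; last first.
  by apply: subset_closure.
pose s (h : R) := (1 + h * h)^-1.
(* The rational parametrization of the unit circle, starting at [u 0 = (1, 0)]; rationality gives
   the continuity of the path. *)
pose u (h : R) : plane R := ((1 - h * h) * s h, 2 * h * s h).
pose f (h : R) : phase R := (x.1, cmul (u h) x.2).
have -> : x = f 0.
  rewrite /f (_ : cmul _ _ = x.2); first by case: x {rx z0 E m0 f}.
  case: x.2 => ? ?.
  by rewrite /cmul /u /s /= !mulr0 addr0 subr0 invr1; congr pair; ring.
have den h : 1 + h * h != 0 :> R.
  by rewrite lt0r_neq0 // ltr_wpDr // -expr2 sqr_ge0.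
have uu h : dot (u h) (u h) = 1.
  by rewrite /dot /u /s /=; field.
have rid : rational_on setT (fun h : R => h).
  by apply: rational_linear => // t; exact: cvg_id.
have rsq := rational_mul rid rid.
have rs : rational_on setT s.
  apply: rational_inv => //; apply: rational_add => //; exact: rational_const.
apply: closure_path.
  apply: continuous_phase; first exact: rational2_const.
  apply: rational2_cmul; last exact: rational2_const.
  split; apply: rational_mul => //.
    by apply: rational_add; [exact: rational_const|exact: rational_opp].
  by apply: rational_mul => //; exact: rational_const.
move=> h h0; split.
  by apply/(regular_levelP n0); rewrite dot_cmul uu mul1r.
rewrite /f /= momentum_cmul.
have := dot_sqr_cross (cpow x.1 n.+1) (mom x).
rewrite m0 expr0n addr0 (dot_momentum E z0) => H.
have H1 : dot (cpow x.1 n.+1) (mom x) != 0.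
  rewrite -sqrf_eq0 H mulf_neq0 ?pnatr_eq0 //.
  by rewrite lt0r_neq0 // dot_cpow_gt0.
rewrite (_ : cross _ _ = (u h).1 * ang x + (u h).2 * dot (cpow x.1 n.+1) (mom x)).
  rewrite m0 mulr0 add0r mulf_neq0 // /u /= mulf_neq0 ?invr_eq0 //.
  by rewrite mulf_neq0 // lt0r_neq0.
by rewrite /cross /dot /=; ring.
Qed.

Lemma first_integral_wall (c : conic R) :
  0 < disc c -> first_integral U 0 (wall_integral n c).
Proof.
move=> d0; split.
- have oO : open [set x : phase R | 0 < dot x.1 x.1].
    apply: open_rational_gt0; apply: rational_dot;
      by apply: rational2_linear => // y; exact: cvg_fst.
  exists [set x | 0 < dot x.1 x.1]; split => //.
    by move=> x /(regular_levelP n0)[]; rewrite -dot_gt0.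
  exact: (rational_smooth oO (rational_wall_integral n c)).
- move=> a b z w zw s t sab tab; exact: joachimsthal_motion zw _ _ _ _ _.
(* Points with nonzero angular momentum are dense in the level, and each of them is a limit of
   independent points; closure is idempotent. *)
- move=> x /closure_rotation; rewrite [X in _ -> X x](closure_id _).1; last first.
    exact: closed_closure.
  apply: closureS => y [ry my]; exact: closure_scaling.
Qed.

Variable c : conic R.

Lemma derive_pulled_conic z (v : plane R) : 'D_v (pulled_conic n c) z =
  cpolar c (cpow z n.+1) (n.+1%:R *: cmul (cpow z n) v).
Proof.
have Dz : is_derive2 z v id v by apply: is_derive2P; exact: is_derive_id.
by have [_ ->] := is_derive_ceval c (is_derive2_cpow n.+1 Dz).
Qed.

Lemma dot_grad_pulled_conic z w : dot w (grad (pulled_conic n c) z) =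
  cpolar c (cpow z n.+1) (n.+1%:R *: cmul (cpow z n) w).
Proof.
rewrite /grad !derive_pulled_conic /cpolar /dot /= /GRing.scale /=.
move: (cmul z (cpow z n)) => q; ring.
Qed.

(** The value at the origin is -1. *)
Lemma pulled_conic_neq0 z : pulled_conic n c z = 0 -> z != 0.
Proof.
move=> H; apply/eqP => z0; move: H; rewrite z0 /pulled_conic.
rewrite (_ : cpow 0 n.+1 = 0); last by congr pair => /=; ring.
by rewrite /ceval /qform /dot /= {z0} => H; lra.
Qed.

(** On the wall the linear term is 1 minus [qform], so by Euler's relation the radial derivative is
    (n+1)(qform + 1) at z^(n+1), which is positive. *)
Lemma grad_pulled_conic_neq0 z : elliptic c ->
  pulled_conic n c z = 0 -> grad (pulled_conic n c) z <> 0.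
Proof.
move=> ec Bz G0; have z0 := pulled_conic_neq0 Bz.
have := dot_grad_pulled_conic z z; rewrite G0 (_ : dot z 0 = 0); last first.
  by rewrite /dot /=; ring.
rewrite (cmulC _ z) -cpowS.
have q0 : cpow z n.+1 != 0 by rewrite -dot_gt0 dot_cpow_gt0.
rewrite (_ : cpolar _ _ _ =
  n.+1%:R * (qform c (cpow z n.+1) + 1 + pulled_conic n c z)); last first.
  by rewrite /pulled_conic /ceval /cpolar /qform /dot /= /GRing.scale /=; ring.
rewrite Bz addr0 => /esym/eqP; rewrite mulf_eq0 pnatr_eq0 /= => /eqP H.
by have := qform_gt0 ec q0; lra.
Qed.

(* Since z ^ n.+1 is conformal, momentum and w make the same angle with the
   images of the normal; on the wall only the squared polar form is left. *)
Lemma wall_integral_reflect z w : elliptic c -> pulled_conic n c z = 0 ->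
  wall_integral n c (z, Defs.reflect (grad (pulled_conic n c) z) w) =
  wall_integral n c (z, w).
Proof.
move=> ec Bz; have z0 := pulled_conic_neq0 Bz.
have E (v : plane R) : cpolar c (cpow z n.+1) (momentum n z v) =
   (n.+1%:R * dot (cpow z n) (cpow z n))^-1 * dot v (grad (pulled_conic n c) z).
  rewrite dot_grad_pulled_conic /momentum; have s0 := lt0r_neq0 (dot_cpow_gt0 n z0).
  move: (cpow z n.+1) (dot _ _) s0 => q s s0.
  have k0 : n.+1%:R != 0 :> R by rewrite pnatr_eq0.
  move: n.+1%:R k0 => k k0.
  rewrite /cpolar /dot /= /GRing.scale /=; field.
  by rewrite s0.
rewrite /wall_integral /joachimsthal -/(pulled_conic n c z) /=.
rewrite -/(pulled_conic n c z) Bz !mul0r !subr0 !E dot_reflect ?mulrN ?sqrrN //.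
by apply/eqP; exact: grad_pulled_conic_neq0.
Qed.

End FirstIntegral.

(** * Polar coordinates, roots, and the quadratic equation on a ray *)

Section Polar.
Variable R : realType.
Implicit Types (z q u l : plane R) (r t theta A L : R).

Definition expi theta : plane R := (cos theta, sin theta).

Lemma dot_expi theta : dot (expi theta) (expi theta) = 1.
Proof. by rewrite /dot /= -!expr2 cos2Dsin2. Qed.

Lemma cpow_expi theta n : cpow (expi theta) n = expi (n%:R * theta).
Proof.
elim: n => [|n IH]; first by rewrite /expi mul0r cos0 sin0.
rewrite cpowS IH /expi mulrS mulrDl mul1r cosD sinD /cmul /=.
by congr pair; ring.
Qed.

(** [acos] sees only the upper half circle; the sign of [y] chooses between its angle and the
    opposite one. *)
Lemma unit_expi u : dot u u = 1 -> exists theta, u = expi theta.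
Proof.
case: u => x y; rewrite /dot /= -!expr2 => E.
have x1 : -1 <= x <= 1.
  rewrite -ler_norml -(@ler_sqr R) ?nnegrE ?normr_ge0 // real_normK ?num_real //.
  by rewrite expr1n -E lerDl sqr_ge0.
have cx : cos (acos x) = x by rewrite acosK // in_itv.
have sx : sin (acos x) = `|y|.
  by rewrite sin_acos // -E addrAC subrr add0r sqrtr_sqr.
case: (leP 0 y) => y0.
  by exists (acos x); rewrite /expi cx sx ger0_norm.
by exists (- acos x); rewrite /expi cosN sinN cx sx ltr0_norm // opprK.
Qed.

Lemma polar_form q : q != 0 ->
  exists r theta, 0 < r /\ q = r *: expi theta.
Proof.
move=> q0; have d0 : 0 < dot q q by rewrite dot_gt0.
pose r := Num.sqrt (dot q q); have r0 : 0 < r by rewrite sqrtr_gt0.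
have r2 : r ^+ 2 = dot q q by rewrite sqr_sqrtr // ltW.
have [theta E] : exists theta, r^-1 *: q = expi theta.
  apply: unit_expi; transitivity (r^-1 ^+ 2 * dot q q).
    by rewrite /dot /= /GRing.scale /=; ring.
  by rewrite -r2 exprVn mulVf // expf_neq0 // lt0r_neq0.
exists r, theta; split => //.
by rewrite -E scalerA mulfV ?scale1r // lt0r_neq0.
Qed.

Definition root_of n r := r `^ (n.+1%:R^-1).

Lemma root_of_gt0 n r : 0 < r -> 0 < root_of n r.
Proof. exact: powR_gt0. Qed.

Lemma root_ofK n r : 0 < r -> root_of n r ^+ n.+1 = r.
Proof.
move=> r0; rewrite -powR_mulrn ?powR_ge0 // -powRrM mulVf ?pnatr_eq0 //.
by rewrite powRr1 // ltW.
Qed.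

Lemma continuous_root_of n r : 0 < r -> {for r, continuous (root_of n)}.
Proof.
move=> r0; have [D _] := is_derive1_powR (n.+1%:R^-1) r0.
by move/derivable1_diffP/differentiable_continuous: D.
Qed.

Lemma cpow_surjective n q : q != 0 -> exists2 z, z != 0 & cpow z n.+1 = q.
Proof.
move=> /polar_form[r [theta [r0 ->]]].
exists (root_of n r *: expi (n.+1%:R^-1 * theta)).
  rewrite scaler_eq0 negb_or lt0r_neq0 ?root_of_gt0 //=.
  by rewrite -dot_gt0 dot_expi.
rewrite cpow_scale root_ofK // cpow_expi mulrA mulfV ?mul1r //.
Qed.

(** The positive root of A t^2 + L t - 1, with the square root moved to a denominator that is
    positive for [A > 0] whatever the sign of [L]. *)
Definition ray_root A L := 2 / (L + Num.sqrt (L ^+ 2 + 4 * A)).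

Lemma ray_root_den A L : 0 < A -> 0 < L + Num.sqrt (L ^+ 2 + 4 * A).
Proof.
move=> A0; have : `|L| < Num.sqrt (L ^+ 2 + 4 * A).
  rewrite -sqrtr_sqr ltr_sqrt ?ltrDl ?mulr_gt0 //.
  by rewrite ltr_wpDl ?sqr_ge0 ?mulr_gt0.
by move=> /ltr_normlP[]; lra.
Qed.

Lemma ray_root_gt0 A L : 0 < A -> 0 < ray_root A L.
Proof. by move=> A0; rewrite divr_gt0 // ray_root_den. Qed.

Lemma ray_rootP A L t : 0 < A -> 0 < t ->
  A * t ^+ 2 + L * t - 1 = 0 <-> t = ray_root A L.
Proof.
move=> A0.
have rootE : A * ray_root A L ^+ 2 + L * ray_root A L - 1 = 0.
  have := ray_root_den L A0; rewrite /ray_root.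
  have : Num.sqrt (L ^+ 2 + 4 * A) ^+ 2 = L ^+ 2 + 4 * A.
    by rewrite sqr_sqrtr // addr_ge0 ?sqr_ge0 ?mulr_ge0 // ltW.
  move: (Num.sqrt _) => D D2 den.
  transitivity ((4 * A - (D ^+ 2 - L ^+ 2)) / (L + D) ^+ 2).
    by field; rewrite lt0r_neq0.
  by rewrite D2 (_ : _ - _ = 0) ?mul0r //; ring.
move=> t0; split=> [E|->//].
have s0 := ray_root_gt0 L A0; move: (ray_root A L) s0 rootE => s s0 Es.
have : (t - s) * (A * (t + s) + L) = 0 by rewrite -[RHS](subrr 0) -{1}E -Es; ring.
move=> /eqP; rewrite mulf_eq0 subr_eq0 => /orP[/eqP//|/eqP H].
(* The other factor would vanish only for two roots of product -1 / A, which is impossible when both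
   are positive. *)
have : t * (A * (t + s) + L) = 1 + A * t * s.
  by rewrite -[LHS]subr0 -E; ring.
rewrite H mulr0 => H0.
have : 0 < A * t * s by rewrite !mulr_gt0.
by move: (A * t * s) H0 => x; lra.
Qed.

End Polar.

(** * Pull-backs of ellipses: coefficients, shape and similarity *)

Section Walls.
Variables (R : realType) (n : nat).
Implicit Types (c : conic R) (z q u l : plane R) (t theta : R).

Definition wall c : set (plane R) := [set z | pulled_conic n c z = 0].

Lemma ceval_ray c u t :
  ceval c (t *: u) = qform c u * t ^+ 2 + dot (linr c) u * t - 1.
Proof. by rewrite /ceval /qform /dot /= /GRing.scale /=; ring. Qed.

(** Every ray from the origin meets the ellipse, and surjectivity of the power map puts the meeting
    point on the second conic too. The linear term changes sign between the rays along [u] and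
    [- u], so the two equations separate both differences. *)
Lemma wall_sub_coeffs c c' u : elliptic c -> u != 0 -> wall c `<=` wall c' ->
  qform c u = qform c' u /\ dot (linr c) u = dot (linr c') u.
Proof.
move=> ec u0 sub.
have ray v : v != 0 -> exists t, [/\ 0 < t,
    qform c v * t ^+ 2 + dot (linr c) v * t - 1 = 0 &
    qform c' v * t ^+ 2 + dot (linr c') v * t - 1 = 0].
  move=> v0; have A0 := qform_gt0 ec v0.
  pose t := ray_root (qform c v) (dot (linr c) v).
  have t0 : 0 < t by exact: ray_root_gt0.
  have E : ceval c (t *: v) = 0 by rewrite ceval_ray; apply/ray_rootP.
  have [|z _ zE] := @cpow_surjective R n (t *: v).
    by rewrite scaler_eq0 negb_or v0 lt0r_neq0.
  have /sub : wall c z by rewrite /wall /pulled_conic /= zE.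
  by rewrite /wall /pulled_conic /= zE ceval_ray => E'; exists t; rewrite -ceval_ray.
have [t [t0 E1 E2]] := ray u u0.
have [|s [s0]] := ray (- u); first by rewrite oppr_eq0.
have qN d : qform d (- u) = qform d u by rewrite /qform /dot /=; ring.
have dN (b : plane R) : dot b (- u) = - dot b u by rewrite /dot /=; ring.
rewrite !qN !dN => E3 E4.
move: (qform c u) (qform c' u) (dot (linr c) u) (dot (linr c') u) E1 E2 E3 E4.
move=> A A' L L' E1 E2 E3 E4.
have H1 : (A - A') * t + (L - L') = 0.
  apply: (mulIf (lt0r_neq0 t0)); rewrite mul0r -[RHS](subrr 0) -{1}E1 -E2; ring.
have H2 : (A - A') * s - (L - L') = 0.
  apply: (mulIf (lt0r_neq0 s0)); rewrite mul0r -[RHS](subrr 0) -{1}E3 -E4; ring.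
have : (A - A') * (t + s) = 0 by rewrite -[RHS]addr0 -{1}H1 -H2; ring.
move=> /eqP; rewrite mulf_eq0 (gt_eqF (addr_gt0 t0 s0)) orbF => /eqP AA.
by move: H1; rewrite AA mul0r add0r => /subr0_eq ->; split=> //; exact: subr0_eq.
Qed.

Lemma wall_inj c c' : elliptic c -> wall c = wall c' -> c = c'.
Proof.
move=> ec E; have H (u : plane R) : u != 0 -> qform c u = qform c' u /\ dot (linr c) u = dot (linr c') u.
  by move=> u0; apply: wall_sub_coeffs => //; rewrite E.
(* In these three directions [qform] takes the values a + b1, a - b1 and 2 (a + b2), which determine
   a, b1 and b2. *)
have [|A1 L1] := H (1, 0); first by rewrite -dot_eq0 /dot /= mulr0 addr0 mulr1 oner_eq0.
have [|A2 L2] := H (0, 1); first by rewrite -dot_eq0 /dot /= mulr0 add0r mulr1 oner_eq0.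
have [|A3 _] := H (1, 1); first by rewrite -dot_eq0 /dot /= mulr1 -mulr2n pnatr_eq0.
case: c c' {E H ec} A1 A2 A3 L1 L2 => a [b1 b2] [g1 g2] [a' [b1' b2'] [g1' g2']].
rewrite /qform /dot /= => *.
by congr Conic; [|congr pair|congr pair]; lra.
Qed.

(** For z = r e^(i theta) the equation is that of a ray with t = r^(n+1), which has exactly one
    positive solution. The angle thus parametrizes the wall, which yields its connectedness. *)
Lemma wall_polar c : elliptic c -> wall c = range (fun theta =>
  let u := cpow (expi theta) n.+1 in
  root_of n (ray_root (qform c u) (dot (linr c) u)) *: expi theta).
Proof.
move=> ec; apply/seteqP.
have A0 theta : 0 < qform c (cpow (expi theta) n.+1).
  by apply: qform_gt0 => //; rewrite cpow_expi -dot_gt0 dot_expi.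
split=> [z Bz|z [theta _ <-]]; last first.
  rewrite /wall /pulled_conic /= cpow_scale root_ofK ?ray_root_gt0 // ceval_ray.
  by apply/ray_rootP => //; exact: ray_root_gt0.
have [r [theta [r0 zE]]] := polar_form (pulled_conic_neq0 Bz).
exists theta => //=; rewrite zE; congr (_ *: _).
move: Bz; rewrite /wall /pulled_conic /= zE cpow_scale ceval_ray.
move=> /ray_rootP <- //; last exact: exprn_gt0.
apply/eqP; rewrite -(@eqrXn2 R n.+1) ?ltW ?root_of_gt0 ?exprn_gt0 //.
by rewrite root_ofK ?exprn_gt0.
Qed.

Lemma connected_wall c : elliptic c -> connected (wall c).
Proof.
move=> ec; rewrite wall_polar //; set f := fun theta => _.
apply: connected_continuous_connected.
  by apply/connected_intervalP => x y _ _ z _.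
apply: continuous_subspaceT => theta.
have ce : {for theta, continuous (fun s : R => expi s : plane R)}.
  by apply: continuous_pair; [exact: continuous_cos | exact: continuous_sin].
have rz : rational2 setT (fun z : plane R => z) by apply: rational2_linear => // y; exact: cvg_id.
have ru := rational2_cpow n.+1 rz.
have comp (h : plane R -> R) : rational_on setT h ->
    {for theta, continuous (fun s : R => h (expi s))}.
  by move=> rh; exact: (continuous_comp ce (rational_continuous rh I)).
have cA : {for theta, continuous (fun s : R => qform c (cpow (expi s) n.+1))}.
  apply: (comp (fun z => qform c (cpow z n.+1))); case: (c) => a b g.
  by apply: rational_qform => //; [exact: rational_const | exact: rational2_const].
have cL : {for theta, continuous (fun s : R => dot (linr c) (cpow (expi s) n.+1))}.
  apply: (comp (fun z => dot (linr c) (cpow z n.+1))).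
  by apply: rational_dot => //; exact: rational2_const.
have A0 : 0 < qform c (cpow (expi theta) n.+1).
  by apply: qform_gt0 => //; rewrite cpow_expi -dot_gt0 dot_expi.
have cR : {for theta, continuous (fun s : R =>
    ray_root (qform c (cpow (expi s) n.+1)) (dot (linr c) (cpow (expi s) n.+1)))}.
  apply: continuousM; first exact: cst_continuous.
  apply: continuousV; first by rewrite lt0r_neq0 // ray_root_den.
  apply: continuousD => //.
  have cD : {for theta, continuous (fun s : R =>
      dot (linr c) (cpow (expi s) n.+1) ^+ 2 + 4 * qform c (cpow (expi s) n.+1))}.
    apply: continuousD; first exact: continuousM.
    by apply: continuousM => //; exact: cst_continuous.
  exact: (continuous_comp cD (@sqrt_continuous R _)).
have crho := continuous_comp cR (continuous_root_of (n := n)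
  (ray_root_gt0 (dot (linr c) (cpow (expi theta) n.+1)) A0)).
apply: (continuous_pair (f := fun s : R => _ * cos s) (g := fun s : R => _ * sin s)).
  by apply: continuousM; [exact: crho | exact: continuous_cos].
by apply: continuousM; [exact: crho | exact: continuous_sin].
Qed.

Lemma wall_nonempty c : elliptic c -> wall c !=set0.
Proof. by move=> ec; rewrite wall_polar //; eexists; exists 0. Qed.

(** The coefficients of the conic composed with q -> l q. *)
Definition pull c l := Conic (modulus c * dot l l)
  (cmul (quadr c) (conjc (cmul l l))) (cmul (linr c) (conjc l)).

Lemma ceval_pull c l q : ceval (pull c l) q = ceval c (cmul l q).
Proof. by rewrite /ceval /qform /dot /= /dot; ring. Qed.

Lemma elliptic_pull c l : l != 0 -> elliptic c -> elliptic (pull c l).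
Proof.
rewrite -dot_gt0 => l0 [a0 d0]; split; first by rewrite mulr_gt0.
rewrite (_ : disc _ = disc c * dot l l ^+ 2) ?mulr_gt0 ?exprn_gt0 //.
by rewrite /disc /dot /= /dot; ring.
Qed.

Lemma wall_pull c l z : wall (pull c (cpow l n.+1)) z <-> wall c (cmul l z).
Proof. by rewrite /wall /pulled_conic /= ceval_pull cpowM. Qed.

Lemma scale_rotateE r theta z : scale_rotate r theta z = cmul (r *: expi theta) z.
Proof. by congr pair; rewrite /= /GRing.scale /=; ring. Qed.

Lemma sim_wall_pull c l : l != 0 ->
  same_up_to_scale_rotation (wall (pull c (cpow l n.+1))) (wall c).
Proof.
move=> l0; have [r [theta [r0 lE]]] := polar_form l0.
exists r, theta; split => //; apply/seteqP; split=> [z Bz|_ [z /wall_pull Bz <-]].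
  (* The preimage of [z] is its quotient by [l], with the inverse written conj l / |l|^2. *)
  have zE : cmul l ((dot l l)^-1 *: cmul (conjc l) z) = z.
    have d0 : dot l l != 0 by rewrite dot_eq0.
    rewrite [RHS]surjective_pairing; move: d0; rewrite /dot => d0.
    by congr pair; rewrite /= /GRing.scale /=; field.
  exists ((dot l l)^-1 *: cmul (conjc l) z); last by rewrite scale_rotateE -lE.
  by apply/wall_pull; rewrite zE.
by rewrite scale_rotateE -lE.
Qed.

Lemma sim_wall c c' : same_up_to_scale_rotation (wall c) (wall c') ->
  exists2 l, l != 0 & wall c = wall (pull c' (cpow l n.+1)).
Proof.
move=> [r [theta [r0 E]]].
have l0 : r *: expi theta != 0.
  by rewrite scaler_eq0 negb_or lt0r_neq0 //= -dot_gt0 dot_expi.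
exists (r *: expi theta) => //.
apply/seteqP; split=> z.
  by move=> Bz; apply/wall_pull; rewrite E; exists z => //; rewrite scale_rotateE.
move=> /wall_pull; rewrite E => -[y By]; rewrite scale_rotateE => H.
(* Multiplication by a nonzero complex number is injective. *)
suff <- : y = z by [].
apply/eqP; rewrite -subr_eq0 -dot_eq0.
have : dot (cmul (r *: expi theta) (y - z)) (cmul (r *: expi theta) (y - z)) = 0.
  rewrite (_ : cmul _ _ = 0); first by rewrite /dot /= mulr0 addr0.
  transitivity (cmul (r *: expi theta) y - cmul (r *: expi theta) z).
    by congr pair; rewrite /= /GRing.scale /=; ring.
  by rewrite H subrr.
rewrite dot_cmul => /eqP; rewrite mulf_eq0 => /orP[|//].
by rewrite (dot_eq0 (_ *: _)) (negbTE l0).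
Qed.

End Walls.

(** * The two parameter families *)

Section Families.
Variables (R : realType) (n : nat).
Implicit Types (c : conic R).

Lemma rational_coordinate m (i : 'I_m) (O : set 'rV[R]_m) :
  rational_on O (fun a => a 0 i).
Proof.
apply: rational_linear => [r x y|a]; first by rewrite !mxE.
exact: coord_continuous.
Qed.

Definition rational_conic (V : normedModType R) (c : V -> conic R) :=
  [/\ rational_on setT (fun y => modulus (c y)),
      rational2 setT (fun y => quadr (c y)) &
      rational2 setT (fun y => linr (c y))].

Lemma rational_conic_comp (V W : normedModType R) (l : V -> W) (c : W -> conic R) :
  linear l -> continuous l -> rational_conic c -> rational_conic (c \o l).
Proof.
move=> ll cl [Ha [b1 b2] [g1 g2]].
have sub f : rational_on [set: W] f -> rational_on setT (f \o l).
  move=> rf; apply: rational_comp => //; apply: rational_sub rf.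
  by [].
by split; [exact: sub Ha | split; [exact: sub b1 | exact: sub b2]
  | split; [exact: sub g1 | exact: sub g2]].
Qed.

Lemma open_elliptic (V : normedModType R) (c : V -> conic R) :
  rational_conic c -> open [set a | elliptic (c a)].
Proof.
move=> [Ha Hb _].
rewrite (_ : [set a | _] = [set a | 0 < modulus (c a)] `&` [set a | 0 < disc (c a)]) //.
apply: openI; first exact: open_rational_gt0.
apply: open_rational_gt0; apply: rational_add; first exact: rational_exp.
by apply: rational_opp; exact: rational_dot.
Qed.

Lemma rational_pulled_conic c (O : set (plane R)) :
  rational_on O (pulled_conic n c).
Proof.
case: c => a b g; apply: rational_ceval.
- exact: rational_const.
- exact: rational2_const.
- exact: rational2_const.
- by apply: rational2_cpow; apply: rational2_linear => // y; exact: cvg_id.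
Qed.

Lemma defines_wall c : elliptic c -> defines (pulled_conic n c) (wall n c).
Proof.
move=> ec; split => //; first exact: (rational_smooth openT (rational_pulled_conic _ _)).
by move=> z; exact: grad_pulled_conic_neq0.
Qed.

(** Ellipticity on [P] makes every slice a defining function, and rationality gives smoothness
    jointly in parameter and point. *)
Lemma wall_parameter_family m (c : 'rV[R]_m -> conic R) (P : set 'rV[R]_m)
    sim (W : set (set (plane R))) :
  rational_conic c -> open P -> P !=set0 -> P `<=` [set a | elliptic (c a)] ->
  (forall a, P a -> W (wall n (c a))) ->
  (forall D, W D -> exists a, P a /\ sim (wall n (c a)) D) ->
  (forall a b, P a -> P b -> sim (wall n (c a)) (wall n (c b)) -> a = b) ->
  parameter_family m sim W.
Proof.
move=> rc oP P0 Pe PW Psurj Pinj; exists P, (fun a => wall n (c a)); split => //.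
exists (fun y : 'rV[R]_m * plane R => pulled_conic n (c y.1) y.2); split; last first.
  by move=> a /Pe ea; exact: (defines_wall ea).
have oPT : open (P `*` [set: plane R]).
  rewrite (_ : _ `*` _ = fst @^-1` P); first by apply: open_comp => // x _; exact: cvg_fst.
  by apply/seteqP; split=> [x []|x].
apply: rational_smooth => //.
have [Ha Hb Hg] : rational_conic (fun y : 'rV[R]_m * plane R => c y.1).
  by apply: (rational_conic_comp (l := fst)) rc => // y; exact: cvg_fst.
have H : rational_on setT (fun y : 'rV[R]_m * plane R => pulled_conic n
    (Conic (modulus (c y.1)) (quadr (c y.1)) (linr (c y.1))) y.2).
  apply: rational_ceval => //; apply: rational2_cpow.
  by apply: rational2_linear => // y; exact: cvg_snd.
rewrite (_ : (fun y => _) = fun y : 'rV[R]_m * plane R => pulled_conic n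
    (Conic (modulus (c y.1)) (quadr (c y.1)) (linr (c y.1))) y.2); last first.
  by apply/funext => y; case: (c y.1).
exact: rational_sub H.
Qed.

Lemma wall_integrable c : (0 < n)%N -> elliptic c ->
  smooth_integrable_wall (force (R := R) n.+1) 0 (wall n c).
Proof.
move=> n0 ec; split; [exact: wall_nonempty | exact: connected_wall |].
exists (pulled_conic n c); split; first exact: defines_wall.
exists (wall_integral n c); split; first by apply: first_integral_wall => //; case: ec.
by move=> z w Bz _; exact: wall_integral_reflect.
Qed.

Local Notation I5 i := (@Ordinal 5 i isT).
Local Notation I3 i := (@Ordinal 3 i isT).

Definition conic5 (a : 'rV[R]_5) : conic R :=
  Conic (a 0 (I5 0)) (a 0 (I5 1), a 0 (I5 2)) (a 0 (I5 3), a 0 (I5 4)).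

Definition conic3 (a : 'rV[R]_3) : conic R :=
  Conic (a 0 (I3 0)) (a 0 (I3 1), a 0 (I3 2)) (1, 0).

Lemma conic5_inj : injective conic5.
Proof.
move=> a b [H0 H1 H2 H3 H4]; apply/rowP => -[i lti].
by case: i lti => [|[|[|[|[|i]]]]] lti //;
  rewrite (bool_irrelevance lti isT).
Qed.

Lemma conic3_inj : injective conic3.
Proof.
move=> a b [H0 H1 H2]; apply/rowP => -[i lti].
by case: i lti => [|[|[|i]]] lti //; rewrite (bool_irrelevance lti isT).
Qed.

Lemma conic5_surj c : exists a, conic5 a = c.
Proof.
case: c => a [b1 b2] [g1 g2].
exists (\row_(i < 5) [:: a; b1; b2; g1; g2]`_i).
by rewrite /conic5 !mxE.
Qed.

Lemma conic3_surj c : linr c = (1, 0) -> exists a, conic3 a = c.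
Proof.
case: c => a [b1 b2] g /= ->.
exists (\row_(i < 3) [:: a; b1; b2]`_i).
by rewrite /conic3 !mxE.
Qed.

Lemma rational_conic5 : rational_conic conic5.
Proof. by split; [|split|split]; exact: rational_coordinate. Qed.

Lemma rational_conic3 : rational_conic conic3.
Proof.
split; first exact: rational_coordinate.
  by split; exact: rational_coordinate.
exact: rational2_const.
Qed.

(* The ellipses centred at the origin are excluded: a nontrivial rotation of the
   q-plane preserves them, so they would be singular points of the quotient. *)
Definition eccentric_walls : set (set (plane R)) :=
  [set wall n c | c in [set c | elliptic c /\ linr c != 0]].

Lemma eccentric_walls5 : parameter_family 5 eq eccentric_walls.
Proof.
pose P := [set a | elliptic (conic5 a)] `&`
  [set a | 0 < dot (linr (conic5 a)) (linr (conic5 a))].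
apply: (@wall_parameter_family 5 conic5 P _ _ rational_conic5).
- apply: openI; first exact: open_elliptic rational_conic5.
  by apply: open_rational_gt0; have [_ _ Hg] := rational_conic5; exact: rational_dot.
(* The circle |q|^2 + Re q = 1 shows that the parameter set is nonempty. *)
- have [a E] := conic5_surj (Conic 1 (0, 0) (1, 0)); exists a.
  by split; rewrite /mkset E; [split; rewrite /disc|]; rewrite /dot /=; lra.
- by move=> a [].
- by move=> a [ea]; rewrite /mkset dot_gt0 => ga; exists (conic5 a).
- move=> _ [c [ec gc] <-]; have [a E] := conic5_surj c; exists a.
  by split; [split; rewrite /mkset E // dot_gt0|rewrite E].
- by move=> a b [ea _] _ /(wall_inj ea)/conic5_inj.
Qed.

Lemma eccentric_walls3 :
  parameter_family 3 (@same_up_to_scale_rotation R) eccentric_walls.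
Proof.
apply: (@wall_parameter_family 3 conic3 [set a | elliptic (conic3 a)] _ _
  rational_conic3) => //.
- exact: open_elliptic rational_conic3.
- have [a E] := @conic3_surj (Conic 1 (0, 0) (1, 0)) erefl; exists a.
  by rewrite /mkset E; split; rewrite /disc /dot /=; lra.
- move=> a ea; exists (conic3 a) => //; split => //=.
  by rewrite -dot_gt0 /dot /= mulr0 addr0 mulr1.
- move=> _ [c [ec gc] <-].
  have d0 : dot (linr c) (linr c) != 0 by rewrite dot_eq0.
  (* Pulling back multiplies the linear part g by conj l, so l = g / |g|^2 turns it into 1; an
     (n+1)-th root of [l] gives the similarity in the z-plane. *)
  pose l := (dot (linr c) (linr c))^-1 *: linr c.
  have l0 : l != 0 by rewrite scaler_eq0 negb_or invr_eq0 d0.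
  have [z z0 zE] := cpow_surjective n l0.
  have [|a E] := @conic3_surj (pull c l).
    move: d0; rewrite /= /l /dot => d0.
    by congr pair; rewrite /= /GRing.scale /=; field.
  exists a; rewrite E -zE; split; last exact: sim_wall_pull.
  by rewrite /= E; exact: elliptic_pull.
- move=> a b ea eb /sim_wall[l l0] /(wall_inj ea) E.
  (* Both linear parts are 1, so the conjugate of l^(n+1) is 1. Then [l] may still be a nontrivial
     root of unity, but the pull-back by its power is the identity. *)
  have lE : cpow l n.+1 = (1, 0).
    move: (cpow l n.+1) (congr1 (@linr R) E) => [x y] /= [H1 H2].
    by congr pair; lra.
  apply: conic3_inj; rewrite E lE.
  case: (conic3 b) => x [y1 y2] [g1 g2].
  by congr Conic; [|congr pair|congr pair]; rewrite /dot /=; ring.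
Qed.

End Families.

Theorem proposition2 (R : realType) (k : nat) (hk : (2 <= k)%N) :
  exists W : set (set (plane R)),
    [/\ forall B, W B -> smooth_integrable_wall (@force R k) 0 B,
        parameter_family 5 eq W &
        parameter_family 3 (@same_up_to_scale_rotation R) W].
Proof.
(* With [k = n + 1] the hypothesis on [k] computes to [0 < n]. *)
case: k hk => [|n] // n0; exists (@eccentric_walls R n); split.
- by move=> _ [c [ec _] <-]; exact: wall_integrable.
- exact: eccentric_walls5.
- exact: eccentric_walls3.
Qed.
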